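(* Let $n\ge 2$ be an integer, let $A\subseteq\mathbb{F}_{2^{n-1}}\setminus\{0\}$ with $|A|=k$ and $0<k<2^{n-1}-3$, and let $\overline{A}^*$ be the complement of $A$ in $\mathbb{F}_{2^{n-1}}\setminus\{0\}$. Suppose $r(\overline{A}^* )\neq|\overline{A}^*|\,(|\overline{A}^*|-1)$. Then there exists a subset of $\mathbb{F}_{2^n}\setminus\{0\}$ of size $k+3$ whose $r$-value is $r(A)+6$.
   Context: For a subset $X$ of a finite additive abelian group, the $r$-value $r(X)$ is the number of ordered pairs $(x,y)\in X\times X$ with $x+y\in X$. Only the additive group of $\mathbb{F}_{2^n}$ is used: its elements are written as vectors $[\alpha_1,\dots,\alpha_n]$ with $\alpha_i\in\{0,1\}$ and addition coordinatewise modulo 2. By convention $\mathbb{F}_{2^{n-1}}$ is regarded as the subset of $\mathbb{F}_{2^n}$ consisting of the vectors with first coordinate $\alpha_1=0$. *)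

(* Defs.v *)
From HB Require Import structures.
From mathcomp Require Import all_boot all_order all_algebra.

Set Implicit Arguments.
Unset Strict Implicit.
Unset Printing Implicit Defensive.

Import GRing.Theory.
Local Open Scope ring_scope.

Definition r_value (G : finZmodType) (X : {set G}) : nat :=
  #|[set p in setX X X | p.1 + p.2 \in X]|.

(* The additive group of F_{2^n}, as coordinate vectors over F_2. *)
Notation F2pow n := 'rV['F_2]_n.

(* The copy of F_{2^(n-1)} inside F_{2^n}. The first coordinate is the one of
   index 0; quantifying over the indices of value 0 avoids forcing n to be a
   successor. Meaningful for 0 < n only. *)
Definition F2pow_pred (n : nat) : {set F2pow n} :=
  [set v : F2pow n | [forall i : 'I_n, (val i == 0%N) ==> (v ord0 i == 0)]].

(* The complement of A in the nonzero elements of F_{2^(n-1)}. *)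
Definition compl_star (n : nat) (A : {set F2pow n}) : {set F2pow n} :=
  (F2pow_pred n :\ 0) :\: A.

(* Main.v *)
Require Import Defs.
From HB Require Import structures.
From mathcomp Require Import all_boot all_order all_algebra.

Set Implicit Arguments.
Unset Strict Implicit.
Unset Printing Implicit Defensive.

Import GRing.Theory.
Local Open Scope ring_scope.

(** Let C be the complement of A in the nonzero elements of the hyperplane.
    If all sums of two distinct elements of C stayed in C, then every pair of
    C x C off the diagonal would count and no pair on it would (x + x = 0 is
    not in C), so r(C) would be |C|(|C| - 1).  The hypothesis on r(C) therefore
    yields a, b in C with a + b in A ([exists_sum_notin]).

    The set sought is B = A u T, where T = {e, e + a, e + b} and e is a vector
    outside the hyperplane.  Call a Schur pair of B a pair (x, y) in B x B with
    x + y in B.  Elements of A are even (first coordinate 0) and those of T are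
    odd, so a Schur pair lies inside A or its triple (x, y, x + y) has two
    terms in T and one in A.  As -1 = 1, the relation z = x + y is symmetric in
    x, y, z, so the three possible positions of the term of A contribute
    equally ([r_value_setU_odd]).  The sums of two distinct elements of T are
    a, b and a + b; only a + b is in A, and it is reached by two ordered pairs
    ([sum_count_coset3]).  Hence r(B) = r(A) + 3 * 2. *)

Section SumCount.

Variable G : finZmodType.
Implicit Types (X Y Z : {set G}) (x y e a b : G).

(** Letting the three sets differ makes this additive in each of them;
    [r_value X] is [sum_count X X X] by definition. *)
Definition sum_count X Y Z : nat :=
  #|[set p in setX X Y | p.1 + p.2 \in Z]|.

Lemma sum_countC X Y Z : sum_count X Y Z = sum_count Y X Z.
Proof.
pose swap (p : G * G) := (p.2, p.1).
have swapK : involutive swap by case.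
rewrite /sum_count -(card_imset _ (inv_inj swapK)); apply: eq_card => p.
rewrite -[p]swapK (mem_imset _ _ (inv_inj swapK)) swapK !inE /=.
by rewrite addrC [(_ \in X) && _]andbC.
Qed.

Lemma sum_count_setUl X X' Y Z : [disjoint X & X'] ->
  sum_count (X :|: X') Y Z = (sum_count X Y Z + sum_count X' Y Z)%N.
Proof.
move=> dX; rewrite /sum_count -cardsUI [X in (_ + X)%N](_ : _ = 0%N) ?addn0.
  by apply: eq_card => p; rewrite !inE -!andbA -andb_orl.
apply/eqP; rewrite cards_eq0; apply/eqP/setP => p; rewrite !inE.
by case Xp: (p.1 \in X); rewrite ?(disjointFr dX Xp) ?andbF.
Qed.

Lemma sum_count_eq0 X Y Z :
  (forall x y, x \in X -> y \in Y -> x + y \notin Z) -> sum_count X Y Z = 0%N.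
Proof.
move=> nZ; apply/eqP; rewrite cards_eq0; apply/eqP/setP => -[x y]; rewrite !inE /=.
by apply/negP => /andP[/andP[Xx Yy]]; apply/negP/nZ.
Qed.

Lemma exists_sum_notin X : (forall x, x + x = 0) -> 0 \notin X ->
  r_value X <> (#|X| * (#|X| - 1))%N ->
  exists a b, [/\ a \in X, b \in X, a != b & a + b \notin X].
Proof.
move=> addxx X0 rX.
case: (boolP [exists a in X, exists b in X, (a != b) && (a + b \notin X)]).
  by case/exists_inP=> a Xa /exists_inP[b Xb /andP[? ?]]; exists a, b.
move/exists_inPn=> closedX; case: rX.
pose diag : {set G * G} := [set (x, x) | x in X].
have -> : r_value X = #|setX X X :\: diag|.
  apply: eq_card => -[x y]; rewrite !inE /= andbC.
  case Xx: (x \in X); case Xy: (y \in X); rewrite ?andbF //= !andbT.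
  have [<-|nxy] := eqVneq x y.
    by rewrite addxx (negPf X0) imset_f.
  have := closedX x Xx; rewrite negb_exists => /forallP/(_ y).
  rewrite Xy nxy /= negbK => ->; apply/esym/imsetP => -[z _ [ex ey]].
  by rewrite ex ey eqxx in nxy.
have diagX : diag \subset setX X X.
  by apply/subsetP => _ /imsetP[x Xx ->]; rewrite inE /= Xx.
rewrite cardsD (setIidPr diagX) cardsX card_imset; last by move=> x y [].
by rewrite mulnBr muln1.
Qed.

Section CharacteristicTwo.

Hypothesis addxx : forall x, x + x = 0.

Let addKx x y : x + (x + y) = y.
Proof. by rewrite addrA addxx add0r. Qed.

Lemma add_eq0 x y : (x + y == 0) = (x == y).
Proof. by rewrite -(inj_eq (addrI x)) addKx addr0 eq_sym. Qed.

(** When x = -x, z = x + y amounts to y = x + z, so the target set can be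
    exchanged with a summand. *)
Lemma sum_countCr X Y Z : sum_count X Y Z = sum_count X Z Y.
Proof.
pose shear (p : G * G) := (p.1, p.1 + p.2).
have shearK : involutive shear by case=> x y; rewrite /shear /= addKx.
rewrite /sum_count -(card_imset _ (inv_inj shearK)); apply: eq_card => p.
rewrite -[p]shearK (mem_imset _ _ (inv_inj shearK)) shearK !inE /= addKx.
by rewrite -!andbA [(_ \in Y) && _]andbC.
Qed.

Lemma sum_count_setUm X Y Y' Z : [disjoint Y & Y'] ->
  sum_count X (Y :|: Y') Z = (sum_count X Y Z + sum_count X Y' Z)%N.
Proof. by move=> dY; rewrite !(sum_countC X) sum_count_setUl. Qed.

Lemma sum_count_setUr X Y Z Z' : [disjoint Z & Z'] ->
  sum_count X Y (Z :|: Z') = (sum_count X Y Z + sum_count X Y Z')%N.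
Proof. by move=> dZ; rewrite !(sum_countCr X Y) sum_count_setUm. Qed.

(** Parity leaves only the triples with zero or two odd terms, and the three
    kinds with two odd terms are exchanged by the symmetries of x + y = z. *)
Lemma r_value_setU_odd (odd : G -> bool) X Y :
    {morph odd : x y / x + y >-> x (+) y} ->
    {in X, forall x, ~~ odd x} -> {in Y, forall y, odd y} ->
  r_value (X :|: Y) = (r_value X + 3 * sum_count Y Y X)%N.
Proof.
move=> oddD evenX oddY.
have dXY : [disjoint X & Y].
  by rewrite disjoint_subset; apply/subsetP => x /evenX; rewrite inE; apply/contra/oddY.
have XXY0 : sum_count X X Y = 0%N.
  apply: sum_count_eq0 => x y /evenX ex /evenX ey; apply/negP => /oddY.
  by rewrite oddD (negPf ex) (negPf ey).
have YYY0 : sum_count Y Y Y = 0%N.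
  apply: sum_count_eq0 => x y /oddY ox /oddY oy; apply/negP => /oddY.
  by rewrite oddD ox oy.
have XYX0 : sum_count X Y X = 0%N by rewrite sum_countCr.
have XYY : sum_count X Y Y = sum_count Y Y X by rewrite sum_countC sum_countCr.
rewrite -[r_value (X :|: Y)]/(sum_count (X :|: Y) (X :|: Y) (X :|: Y)).
rewrite sum_count_setUl // !sum_count_setUm // !sum_count_setUr //.
rewrite !(sum_countC Y X) XXY0 YYY0 XYX0 XYY.
by rewrite !addn0 !add0n -addnA !mulSn mul0n addn0.
Qed.

Lemma sum_count_coset3 X e a b : 0 \notin X ->
    a \notin X -> b \notin X -> a + b \in X ->
  sum_count [set e; e + a; e + b] [set e; e + a; e + b] X = 2%N.
Proof.
move=> X0 Xa Xb Xab.
have addeD x y : (e + x) + (e + y) = x + y by rewrite addrACA addxx add0r.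
have neq_ab : a != b by rewrite -add_eq0; apply: contraNneq X0 => <-.
have -> : 2%N = #|[set (e + a, e + b); (e + b, e + a)] : {set G * G}|.
  by rewrite cards2 xpair_eqE (inj_eq (addrI e)) (negPf neq_ab).
apply: eq_card => p; apply/idP/idP; rewrite !inE; last first.
  by case/orP=> /eqP-> /=; rewrite addeD ?[b + a]addrC Xab !eqxx !orbT.
(* Of the nine sums of two elements of the triple, only those giving a + b
   survive; e cancels in each. *)
case: p => x y /= /andP[/andP[]].
do 2![case/orP=> [/orP[]|] /eqP->]; rewrite ?addeD ?addxx ?addKx;
  rewrite ?(negPf X0) ?(negPf Xa) ?(negPf Xb) ?eqxx ?orbT //.
- by rewrite addrC addKx (negPf Xa).
- by rewrite addrC addKx (negPf Xb).
Qed.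

Lemma card_coset3 e a b : a != 0 -> b != 0 -> a != b ->
  #|[set e; e + a; e + b]| = 3%N.
Proof.
have neq_e x : x != 0 -> (e == e + x) = false.
  by move/negPf=> x0; rewrite -{1}[e]addr0 (inj_eq (addrI e)) eq_sym.
move=> a0 b0 ab; rewrite setUC cardsU1 cards2 !inE (inj_eq (addrI e)).
by rewrite neq_e // [_ == e]eq_sym neq_e // eq_sym (negPf ab).
Qed.

End CharacteristicTwo.

End SumCount.

Lemma addvv_F2 n (v : F2pow n) : v + v = 0.
Proof.
by rewrite -mulr2n -scaler_nat (_ : 2%:R = 0 :> 'F_2) ?scale0r //; apply/val_inj.
Qed.

Lemma neq0D_F2 (x y : 'F_2) : (x + y != 0) = (x != 0) (+) (y != 0).
Proof. by case: x y => [[|[|m]] ltm2] [[|[|p]] ltp2]. Qed.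

Theorem proposition4p7 (n k : nat) (hn : (2 <= n)%N) (A : {set F2pow n})
    (hA : A \subset F2pow_pred n :\ 0)
    (hAk : #|A| = k)
    (hk0 : (0 < k)%N)
    (hk : (k < 2 ^ (n - 1) - 3)%N)
    (hr : r_value (compl_star A) <>
          (#|compl_star A| * (#|compl_star A| - 1))%N) :
  exists B : {set F2pow n},
    [/\ B \subset [set: F2pow n] :\ 0,
        #|B| = (k + 3)%N
      & r_value B = (r_value A + 6)%N].
Proof.
pose i0 : 'I_n := Ordinal (ltnW hn).
pose odd (v : F2pow n) := v ord0 i0 != 0.
have addxx := @addvv_F2 n.
have oddD : {morph odd : x y / x + y >-> x (+) y}.
  by move=> x y; rewrite /odd mxE neq0D_F2.
have odd0 : odd 0 = false by rewrite /odd mxE eqxx.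
have predE v : (v \in F2pow_pred n) = ~~ odd v.
  rewrite inE negbK; apply/forallP/idP => [/(_ i0) //|v0 i].
  apply/implyP => /eqP i_0; suff -> : i = i0 by [].
  exact: val_inj.
have A0 : 0 \notin A by apply/negP => /(subsetP hA); rewrite !inE eqxx.
have evenA : {in A, forall v, ~~ odd v}.
  by move=> v /(subsetP hA); rewrite in_setD1 predE => /andP[].
have complE v : (v \in compl_star A) = [&& v \notin A, v != 0 & ~~ odd v].
  by rewrite in_setD in_setD1 predE.
have [|a [b [Ca Cb neq_ab Cab]]] := exists_sum_notin addxx _ hr.
  by rewrite complE eqxx andbF.
move: Ca Cb; rewrite !complE => /and3P[Aa a0 ea] /and3P[Ab b0 eb].
have Aab : a + b \in A.
  apply: contraNT Cab => nAab.
  by rewrite complE nAab add_eq0 // neq_ab oddD (negPf ea) (negPf eb).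
pose e : F2pow n := delta_mx ord0 i0.
have odd_e : odd e by rewrite /odd mxE !eqxx.
pose T := [set e; e + a; e + b].
have oddT : {in T, forall v, odd v}.
  move=> v; rewrite !inE => /orP[/orP[]|] /eqP-> //.
    by rewrite oddD odd_e (negPf ea).
  by rewrite oddD odd_e (negPf eb).
have T0 : 0 \notin T by apply/negP => /oddT; rewrite odd0.
exists (A :|: T); split.
- by rewrite subsetD1 subsetT inE negb_or A0 T0.
- have AT0 : A :&: T = set0.
    apply/setP => v; rewrite in_setI in_set0; apply/negP => /andP[/evenA ev /oddT].
    exact/negP.
  by rewrite cardsU AT0 cards0 subn0 hAk card_coset3.
- by rewrite (r_value_setU_odd addxx oddD evenA oddT) sum_count_coset3.
Qed.
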